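(* Let $n\ge2$. For a real symmetric $n\times n$ matrix $\mathcal{Q}$ that is positive semidefinite with $\ker(\mathcal{Q})=\operatorname{span}(\bm{1})$, let $\Omega(\mathcal{Q})$ be the $n\times n$ matrix with entries $\Omega(\mathcal{Q})_{ab}=(\bm{1}_a-\bm{1}_b)^{\top}\mathcal{Q}^{\dagger}(\bm{1}_a-\bm{1}_b)$. Then the set of distance matrices of metrics of strict negative type on $n$ points coincides with the set $\{\Omega(\mathcal{Q}):\mathcal{Q}\text{ symmetric positive semidefinite with }\ker(\mathcal{Q})=\operatorname{span}(\bm{1})\}$. In other words, the class of strict negative type metrics coincides with the class of generalized resistance metrics.
   Context: Such a $\mathcal{Q}$ is the Laplacian of a (possibly signed) undirected graph on $[n]$: $\mathcal{Q}\bm{1}=\bm{0}$ and off-diagonal entries may have either sign. $\mathcal{Q}^{\dagger}$ is the Moore–Penrose pseudoinverse; $R(a,b)=\Omega(\mathcal{Q})_{ab}$ is called the generalized effective resistance, and the corresponding metric the generalized resistance metric. For a metric $d$ on a finite set $\{1,\dots,n\}$, its distance matrix is $D=(d(i,j))_{i,j\in[n]}$; $d$ is of negative type if $\bm{f}^{\top}D\bm{f}\le0$ for all $\bm{f}\in\mathbb{R}^n$ with $\bm{f}^{\top}\bm{1}=0$, and of strict negative type if $\bm{f}^{\top}D\bm{f}<0$ for all nonzero $\bm{f}$ with $\bm{f}^{\top}\bm{1}=0$.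
   Formalization: As Ω(Q) can violate the triangle inequality (weights 2, 2, −2/3 on a triangle give resistances 1, 1, 3), the equality is proved for those Q with Ω(Q) a metric, and also for all Q with ''metric'' not requiring the triangle inequality. *)

(* Defs.v *)
From HB Require Import structures.
From mathcomp Require Import all_boot all_order all_algebra.
From mathcomp Require Import boolp classical_sets reals.

Set Implicit Arguments.
Unset Strict Implicit.
Unset Printing Implicit Defensive.

Import Order.TTheory GRing.Theory Num.Theory.
Local Open Scope ring_scope.
Local Open Scope classical_set_scope.

(* mathcomp's pinvmx is only a one-sided partial inverse, hence the Penrose
   conditions here (real matrices, so the adjoint is the transpose). *)
Definition penrose (R : realType) m n (A : 'M[R]_(m, n)) (X : 'M[R]_(n, m)) :=
  [/\ A *m X *m A = A, X *m A *m X = X,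
      (A *m X)^T = A *m X & (X *m A)^T = X *m A].

(* The default value 0 is never used, see mp_pinvP. *)
Definition mp_pinv (R : realType) m n (A : 'M[R]_(m, n)) : 'M[R]_(n, m) :=
  xget 0 [set X | penrose A X].

Lemma gram_unit (R : realType) r n (B : 'M[R]_(r, n)) :
  row_free B -> B *m B^T \in unitmx.
Proof.
move=> Bfree; rewrite -row_free_unit -kermx_eq0; apply/rowV0P => v.
move/sub_kermxP => vBB.
have : (v *m B) *m (v *m B)^T = 0.
  by rewrite trmx_mul mulmxA -(mulmxA v) vBB mul0mx.
move/matrixP/(_ 0 0); rewrite !mxE => vB2.
apply/eqP; rewrite -(mulmx_free_eq0 v Bfree); apply/eqP/rowP => j.
have vB_ge0 i : true -> 0 <= (v *m B) 0 i * (v *m B)^T i 0.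
  by move=> _; rewrite !mxE -expr2 sqr_ge0.
move/eqP: vB2; rewrite psumr_eq0 // => /allP /(_ j (mem_index_enum j)) /=.
by rewrite [_^T j 0]mxE -expr2 sqrf_eq0 => /eqP ->; rewrite mxE.
Qed.

Lemma penrose_exists (R : realType) m n (A : 'M[R]_(m, n)) :
  exists X, penrose A X.
Proof.
have key r (C : 'M[R]_(m, r)) (B : 'M[R]_(r, n)) :
    B *m B^T \in unitmx -> C^T *m C \in unitmx ->
    penrose (C *m B) (B^T *m invmx (B *m B^T) *m invmx (C^T *m C) *m C^T).
  move=> BBu CCu; set X := _ *m C^T.
  have AX : C *m B *m X = C *m invmx (C^T *m C) *m C^T.
    by rewrite /X !mulmxA -(mulmxA C B) -(mulmxA C (B *m _)) mulmxV ?mulmx1.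
  have XA : X *m (C *m B) = B^T *m invmx (B *m B^T) *m B.
    rewrite /X !mulmxA -(mulmxA _ C^T C).
    by rewrite -(mulmxA _ (invmx (C^T *m C))) mulVmx ?mulmx1.
  split.
  - rewrite AX mulmxA -(mulmxA _ C^T C) -(mulmxA C (invmx _)).
    by rewrite mulVmx ?mulmx1.
  - rewrite XA /X !mulmxA -(mulmxA _ B B^T) -(mulmxA B^T (invmx _)).
    by rewrite mulVmx ?mulmx1.
  - by rewrite AX !trmx_mul trmx_inv trmx_mul trmxK mulmxA.
  - by rewrite XA !trmx_mul trmx_inv trmx_mul trmxK mulmxA.
rewrite -[A]mulmx_base; eexists; apply: key.
  exact/gram_unit/row_base_free.
rewrite -{2}[col_base A]trmxK; apply: gram_unit.
by rewrite /row_free mxrank_tr; exact: col_base_full.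
Qed.

Lemma mp_pinvP (R : realType) m n (A : 'M[R]_(m, n)) : penrose A (mp_pinv A).
Proof.
have [X AX] := penrose_exists A.
exact: (@xgetPex _ 0 [set Y | penrose A Y] (ex_intro _ X AX)).
Qed.

Lemma penrose_uniq (R : realType) m n (A : 'M[R]_(m, n)) X Y :
  penrose A X -> penrose A Y -> X = Y.
Proof.
move=> [AXA XAX AXt XAt] [AYA YAY AYt YAt].
have AXY : A *m X = A *m Y.
  rewrite -AXt -{1}AYA -mulmxA trmx_mul AXt AYt.
  by rewrite mulmxA AXA.
have XYA : X *m A = Y *m A.
  rewrite -XAt -{1}AYA -mulmxA mulmxA trmx_mul XAt YAt.
  by rewrite -mulmxA (mulmxA A) AXA.
by rewrite -XAX XYA -mulmxA AXY mulmxA YAY.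
Qed.

Section Definitions.
Variables (R : realType) (n : nat).

Definition quad (M : 'M[R]_n) (f : 'cV[R]_n) : R := (f^T *m M *m f) 0 0.

Definition ones : 'cV[R]_n := const_mx 1.

Definition psd (M : 'M[R]_n) := forall f : 'cV[R]_n, 0 <= quad M f.

Definition ker_is_span_ones (M : 'M[R]_n) :=
  forall f : 'cV[R]_n, M *m f = 0 <-> exists c : R, f = c *: ones.

Definition is_laplacian (Q : 'M[R]_n) :=
  [/\ Q^T = Q, psd Q & ker_is_span_ones Q].

Definition ind (a : 'I_n) : 'cV[R]_n := delta_mx a 0.

Definition Omega (Q : 'M[R]_n) : 'M[R]_n :=
  \matrix_(a, b) quad (mp_pinv Q) (ind a - ind b).

Definition is_semimetric (d : 'I_n -> 'I_n -> R) :=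
  [/\ forall i j, 0 <= d i j,
      forall i j, d i j = 0 <-> i = j
    & forall i j, d i j = d j i].

Definition triangle_ineq (d : 'I_n -> 'I_n -> R) :=
  forall i j k, d i k <= d i j + d j k.

Definition is_metric (d : 'I_n -> 'I_n -> R) :=
  is_semimetric d /\ triangle_ineq d.

Definition distance_matrix (d : 'I_n -> 'I_n -> R) : 'M[R]_n :=
  \matrix_(i, j) d i j.

Definition strict_negative_type (d : 'I_n -> 'I_n -> R) :=
  forall f : 'cV[R]_n, f != 0 -> f^T *m ones = 0 ->
    quad (distance_matrix d) f < 0.

(* Omega Q satisfies the triangle inequality for some but not all signed
   Laplacians Q: edge weights 2, 2 and -2/3 on a triangle give the resistances
   1, 1 and 3. A generalized resistance metric is thus a metric whose distance
   matrix is some Omega Q. *)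
Definition is_generalized_resistance_metric (d : 'I_n -> 'I_n -> R) :=
  is_metric d /\ exists2 Q, is_laplacian Q & distance_matrix d = Omega Q.

End Definitions.

Arguments ones {R n}.

(* Main.v *)
Require Import Defs.
From HB Require Import structures.
From mathcomp Require Import all_boot all_order all_algebra.
From mathcomp Require Import boolp classical_sets reals.
From mathcomp Require Import ring lra.

(** The pseudoinverse [X] of a Laplacian is again a Laplacian, and on vectors
    orthogonal to [ones] the form of [Omega Q] is [-2] times that of [X], hence
    negative definite. Conversely, if [D] is of strict negative type and [P] is
    the projection along [ones], then [X := - 1/2 P D P] is a Laplacian whose
    resistances [X_aa + X_bb - 2 X_ab] are the entries of [D], because
    [P (e_a - e_b) = e_a - e_b]; so [D = Omega Q] for [Q] the pseudoinverse of
    [X]. *)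

Import Order.TTheory GRing.Theory Num.Theory.
Local Open Scope ring_scope.
Local Open Scope classical_set_scope.

Section Pseudoinverse.
Context {R : realType}.

Lemma penrose_sym {m n} (A : 'M[R]_(m, n)) X : penrose A X -> penrose X A.
Proof. by case. Qed.

Lemma penrose_tr {m n} (A : 'M[R]_(m, n)) X : penrose A X -> penrose A^T X^T.
Proof.
move=> [AXA XAX AXt XAt]; split.
- by rewrite -!trmx_mul mulmxA AXA.
- by rewrite -!trmx_mul mulmxA XAX.
- by rewrite -trmx_mul XAt.
- by rewrite -trmx_mul AXt.
Qed.

Lemma mp_pinvK {m n} : cancel (@mp_pinv R m n) (@mp_pinv R n m).
Proof.
move=> A; apply: (penrose_uniq (mp_pinvP (mp_pinv A))).
exact: penrose_sym (mp_pinvP A).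
Qed.

Lemma mp_pinv_tr {m n} (A : 'M[R]_(m, n)) : mp_pinv A^T = (mp_pinv A)^T.
Proof. exact: penrose_uniq (mp_pinvP _) (penrose_tr _ _ (mp_pinvP A)). Qed.

(** The product [Q X] with the pseudoinverse [X] is symmetric, and its transpose is [X Q] because
    [X] inherits the symmetry of [Q]. *)
Lemma mp_pinv_comm {n} (Q : 'M[R]_n) :
  Q^T = Q -> Q *m mp_pinv Q = mp_pinv Q *m Q.
Proof.
move=> Qt; have [_ _ <- _] := mp_pinvP Q.
by rewrite trmx_mul -mp_pinv_tr Qt.
Qed.

(** By commutation, [X f = X Q X f = X X Q f]. *)
Lemma mp_pinv_ker {n} (Q : 'M[R]_n) (f : 'cV[R]_n) :
  Q^T = Q -> Q *m f = 0 -> mp_pinv Q *m f = 0.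
Proof.
move=> Qt Qf; have [_ <- _ _] := mp_pinvP Q.
by rewrite -mulmxA (mulmxA _ _ f) -!mulmxA (mulmxA Q) mp_pinv_comm //
  -(mulmxA _ Q) Qf !mulmx0.
Qed.

(** From [X = X Q X], the form of [X] at [f] is that of [Q] at [X f]. The kernels agree because
    [mp_pinv_ker] applies in both directions, [mp_pinv] being an involution. *)
Lemma mp_pinv_laplacian {n} (Q : 'M[R]_n) :
  is_laplacian Q -> is_laplacian (mp_pinv Q).
Proof.
move=> [Qt Qpsd Qker].
have Xt : (mp_pinv Q)^T = mp_pinv Q by rewrite -mp_pinv_tr Qt.
split=> // f.
  have [_ XQX _ _] := mp_pinvP Q.
  have := Qpsd (mp_pinv Q *m f).
  by rewrite /quad trmx_mul Xt -!mulmxA (mulmxA Q) (mulmxA _ (Q *m _))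
    (mulmxA (mp_pinv Q) Q) XQX !mulmxA.
rewrite -Qker; split; last exact: mp_pinv_ker.
by move/(mp_pinv_ker _ _ Xt); rewrite mp_pinvK.
Qed.

End Pseudoinverse.

Section QuadraticForms.
Context {R : realType} {n : nat}.
Implicit Types (X D : 'M[R]_n) (f g : 'cV[R]_n).

Lemma quadZ c X f : quad (c *: X) f = c * quad X f.
Proof. by rewrite /quad -scalemxAr -scalemxAl mxE. Qed.

Lemma quadN X f : quad X (- f) = quad X f.
Proof. by rewrite /quad [(- f)^T]linearN /= mulNmx mulmxN mulNmx opprK. Qed.

Lemma quadD_sym X f g : X^T = X ->
  quad X (f + g) = quad X f + quad X g + 2 * (f^T *m X *m g) 0 0.
Proof.
move=> Xt; have gXf : g^T *m X *m f = (f^T *m X *m g)^T.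
  by rewrite !trmx_mul trmxK Xt mulmxA.
rewrite /quad [(f + g)^T]linearD /= !mulmxDl !mulmxDr gXf.
have mxDE (A B : 'M[R]_1) : (A + B) 0 0 = A 0 0 + B 0 0 by rewrite mxE.
by rewrite !mxDE [_^T 0 0]mxE; ring.
Qed.

Lemma quad_indB X a b :
  quad X (ind R a - ind R b) = X a a + X b b - X a b - X b a.
Proof.
rewrite /quad /ind [(_ - _)^T]linearB /= !trmx_delta !mulmxBl !mulmxBr.
by rewrite -!rowE -!colE !mxE; ring.
Qed.

(** Moving from [f] along [h = X f] changes the form at first order by [2 t |h|^2], which would make
    it negative for small [t < 0] unless [h = 0]. *)
Lemma psd_ker X f : X^T = X -> psd X -> quad X f = 0 -> X *m f = 0.
Proof.
move=> Xt Xpsd Xf0; set h := X *m f.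
have Et t : quad X (f + t *: h) = t ^+ 2 * quad X h + 2 * t * (h^T *m h) 0 0.
  rewrite quadD_sym // Xf0 /quad -!scalemxAr [(t *: h)^T]linearZ /= -!scalemxAl.
  by rewrite /h trmx_mul Xt !mxE; ring.
have hh : (h^T *m h) 0 0 = \sum_i h i 0 ^+ 2.
  by rewrite mxE; apply: eq_bigr => i _; rewrite mxE expr2.
have hh0 : (h^T *m h) 0 0 = 0.
  have c0 := Xpsd h; set c := quad X h in Et c0.
  have s0 : 0 <= (h^T *m h) 0 0 by rewrite hh sumr_ge0 // => i _; exact: sqr_ge0.
  set s : R := (h^T *m h) 0 0 in Et s0 *.
  (* The minimizer would be [t = - s / c]; the shift to [c + 1] keeps the denominator positive when
     [c = 0], and the value is still negative unless [s = 0]. *)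
  have := Xpsd (f + (- (s / (c + 1))) *: h); rewrite Et.
  have c1 : 0 < c + 1 by lra.
  have -> : (- (s / (c + 1))) ^+ 2 * c + 2 * - (s / (c + 1)) * s
          = - (s ^+ 2 * (c + 2) / (c + 1) ^+ 2) by field; rewrite gt_eqF.
  rewrite oppr_ge0 pmulr_lle0 ?invr_gt0 ?exprn_gt0 // pmulr_lle0; last lra.
  by move=> s20; apply/eqP; rewrite -sqrf_eq0 eq_le s20 sqr_ge0.
apply/colP => i; rewrite [RHS]mxE; apply/eqP; rewrite -sqrf_eq0.
move/eqP: hh0; rewrite hh psumr_eq0; last by move=> j _; exact: sqr_ge0.
by move=> /allP /(_ i (mem_index_enum i)).
Qed.

End QuadraticForms.

Section Resistance.
Context {R : realType} {n : nat}.
Implicit Types (X D Q : 'M[R]_n) (f g : 'cV[R]_n).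

Lemma tr_mul_ones f : (f^T *m ones) 0 0 = \sum_i f i 0.
Proof. by rewrite mxE; apply: eq_bigr => i _; rewrite !mxE mulr1. Qed.

Lemma indB_ones (a b : 'I_n) : (ind R a - ind R b)^T *m ones = 0.
Proof.
rewrite [(_ - _)^T]linearB /= /ind !trmx_delta mulmxBl -!rowE.
by apply/rowP => i; rewrite !mxE subrr.
Qed.

Lemma span_ones_orth (c : R) :
  (0 < n)%N -> (c *: ones)^T *m (ones : 'cV_n) = 0 -> c = 0.
Proof.
move=> n0 /matrixP /(_ 0 0); rewrite tr_mul_ones [RHS]mxE.
under eq_bigr do rewrite !mxE mulr1.
rewrite sumr_const card_ord => /eqP; rewrite mulrn_eq0 => /orP[|/eqP//].
by case: (n) n0.
Qed.

(** A zero of the form lies in the kernel by [psd_ker], so it is a multiple of [ones]; orthogonality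
    to [ones] then forces it to vanish. *)
Lemma laplacian_quad_gt0 X f : (0 < n)%N -> is_laplacian X ->
  f != 0 -> f^T *m ones = 0 -> 0 < quad X f.
Proof.
move=> n0 [Xt Xpsd Xker] f0 f1; rewrite lt_def Xpsd andbT.
apply: contra_neq f0 => Xf.
have /Xker[c fc] := psd_ker _ _ Xt Xpsd Xf.
by rewrite fc in f1 *; rewrite (span_ones_orth _ n0 f1) scale0r.
Qed.

Lemma ind_inj : injective (@ind R n).
Proof.
move=> a b /matrixP /(_ a 0); rewrite !mxE !eqxx /= andbT.
by case: eqVneq => // _ /eqP; rewrite oner_eq0.
Qed.

(** With [u] the diagonal of [X], [Omega Q = u 1^T + 1 u^T - 2 X], and the two rank-one terms vanish
    on vectors orthogonal to [ones]. *)
Lemma quad_Omega Q f : Q^T = Q -> f^T *m ones = 0 ->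
  quad (Omega Q) f = - 2 * quad (mp_pinv Q) f.
Proof.
move=> Qt f1; set X := mp_pinv Q.
have Xt : X^T = X by rewrite -mp_pinv_tr Qt.
pose u : 'cV[R]_n := \col_a X a a.
have -> : Omega Q = u *m ones^T + ones *m u^T + (- 2) *: X.
  apply/matrixP => a b; rewrite mxE quad_indB -/X.
  have -> : X b a = X a b by rewrite -{1}Xt mxE.
  by rewrite !mxE !big_ord1 !mxE; ring.
have f1' : ones^T *m f = 0 by rewrite -[LHS]trmxK trmx_mul trmxK f1 trmx0.
rewrite -quadZ /quad !mulmxDr !mulmxDl.
by rewrite -2!(mulmxA f^T) -(mulmxA u) f1' mulmxA mulmx0 add0r
  (mulmxA f^T) (mulmxA f^T) f1 !mul0mx add0r.
Qed.

Lemma Omega_semimetric Q :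
  (0 < n)%N -> is_laplacian Q -> is_semimetric (Omega Q).
Proof.
move=> n0 Ql; have Xl := mp_pinv_laplacian _ Ql.
have [_ Xpsd _] := Xl.
split=> i j; rewrite mxE; first exact: Xpsd.
  split=> [|->]; last by rewrite subrr /quad mulmx0 mxE.
  have [/eqP|ne0] := eqVneq (ind R i - ind R j) 0.
    by rewrite subr_eq0 => /eqP /ind_inj.
  by have := laplacian_quad_gt0 _ _ n0 Xl ne0 (indB_ones _ _) => /[swap] ->;
    rewrite ltxx.
by rewrite mxE -quadN opprB.
Qed.

(** The argument [D] is coerced to a function of two indices; this lets [Omega Q] itself serve as a
    distance. *)
Lemma distance_matrix_fun D : distance_matrix D = D.
Proof. by apply/matrixP => i j; rewrite mxE. Qed.

Lemma Omega_strict_negative_type Q :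
  (0 < n)%N -> is_laplacian Q -> strict_negative_type (Omega Q).
Proof.
move=> n0 Ql f f0 f1; have [Qt _ _] := Ql.
rewrite distance_matrix_fun quad_Omega // mulNr oppr_lt0 mulr_gt0 //.
exact: laplacian_quad_gt0 n0 (mp_pinv_laplacian _ Ql) f0 f1.
Qed.

Lemma strict_negative_type_Omega (d : 'I_n -> 'I_n -> R) : (0 < n)%N ->
  is_semimetric d -> strict_negative_type d ->
  exists2 Q, is_laplacian Q & distance_matrix d = Omega Q.
Proof.
move=> n0 [_ d0 dC] dneg; set D := distance_matrix d in dneg *.
have n0R : (n%:R : R) != 0 by rewrite pnatr_eq0 -lt0n.
have ones2 : (ones : 'cV[R]_n)^T *m ones = n%:R%:M.
  apply/matrixP => i j; rewrite !ord1 tr_mul_ones.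
  under eq_bigr do rewrite mxE.
  by rewrite sumr_const card_ord !mxE eqxx.
(* [J] is the orthogonal projection onto the span of [ones], and [P] the complementary centering
   projection. *)
pose J : 'M[R]_n := n%:R^-1 *: (ones *m ones^T).
pose P := 1%:M - J.
have Pt : P^T = P by rewrite /P /J linearB linearZ /= trmx1 trmx_mul trmxK.
have P1 : P *m ones = 0.
  rewrite /P /J mulmxBl mul1mx -scalemxAl -mulmxA ones2 mul_mx_scalar.
  by rewrite scalerA mulVf // scale1r subrr.
have P_orth f : (P *m f)^T *m ones = 0 by rewrite trmx_mul Pt -mulmxA P1 mulmx0.
have P_fix f : f^T *m ones = 0 -> P *m f = f.
  move=> f1; rewrite /P /J mulmxBl mul1mx -scalemxAl -mulmxA.
  have -> : ones^T *m f = 0 by rewrite -[LHS]trmxK trmx_mul trmxK f1 trmx0.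
  by rewrite mulmx0 scaler0 subr0.
pose X := (- 2^-1) *: (P *m D *m P).
have Dt : D^T = D by apply/matrixP => i j; rewrite !mxE dC.
have quadX f : quad X f = - 2^-1 * quad D (P *m f).
  by rewrite quadZ /quad trmx_mul Pt !mulmxA.
have Xt : X^T = X by rewrite /X linearZ /= !trmx_mul Pt Dt mulmxA.
have Xl : is_laplacian X.
  split=> // f.
    rewrite quadX; have [->|Pf0] := eqVneq (P *m f) 0.
      by rewrite /quad mulmx0 mxE mulr0.
    by have := dneg _ Pf0 (P_orth f); rewrite -/D; lra.
  split=> [Xf|[c ->]]; last first.
    by rewrite -scalemxAr /X -scalemxAl -(mulmxA (P *m D)) P1 mulmx0 !scaler0.
  have [Pf0|Pf0] := eqVneq (P *m f) 0.
    (* Since [P f = 0], [f = J f], so the coefficient is the mean of the entries of [f]. *)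
    exists (n%:R^-1 * (ones^T *m f) 0 0).
    apply/eqP; rewrite -subr_eq0 -Pf0 /P /J mulmxBl mul1mx -scalemxAl -mulmxA.
    by rewrite -scalerA [ones^T *m f]mx11_scalar mul_mx_scalar !mxE eqxx mulr1n.
  (* If [P f] were nonzero, strict negativity would make [quad X f] positive, whereas [X f = 0]
     makes it zero. *)
  have := dneg _ Pf0 (P_orth f); rewrite -/D.
  have := quadX f; rewrite {1}/quad -mulmxA Xf mulmx0 mxE.
  by lra.
exists (mp_pinv X); first exact: mp_pinv_laplacian.
apply/matrixP => a b; rewrite [RHS]mxE mp_pinvK quadX P_fix ?indB_ones //.
have dii i : d i i = 0 by apply/d0.
(* With zero diagonal and symmetry, the entry is [- 1/2 (- 2 d a b) = d a b]. *)
by rewrite quad_indB !mxE (dC b a) !dii; field.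
Qed.

End Resistance.

(** As [Omega Q] may violate the triangle inequality, the coincidence is stated among metrics, once
    for matrices and once for the metrics themselves, and then for all Laplacians with semimetrics
    in place of metrics. *)
Theorem theorem4p2 (R : realType) (n : nat) (hn : (2 <= n)%N) :
  (@distance_matrix R n @`
     [set d : 'I_n -> 'I_n -> R | is_metric d /\ strict_negative_type d]
   = @Omega R n @` [set Q | is_laplacian Q /\ is_metric (Omega Q)])
  /\ ([set d : 'I_n -> 'I_n -> R | is_metric d /\ strict_negative_type d]
   = [set d | is_generalized_resistance_metric d])
  /\ (@distance_matrix R n @`
     [set d : 'I_n -> 'I_n -> R | is_semimetric d /\ strict_negative_type d]
   = @Omega R n @` [set Q | is_laplacian Q]).
Proof.
have n0 : (0 < n)%N by exact: ltnW.
have dE (d : 'I_n -> 'I_n -> R) : fun_of_matrix (distance_matrix d) = d.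
  by apply/funext => i; apply/funext => j; rewrite mxE.
split; [|split].
- apply/seteqP; split=> [_ [d [dm dneg] <-]|_ [Q [Ql Qm] <-]] /=.
    have [Q Ql dQ] := strict_negative_type_Omega _ n0 dm.1 dneg.
    by exists Q => //; split=> //; rewrite -dQ dE.
  exists (Omega Q); last exact: distance_matrix_fun.
  by split=> //; exact: Omega_strict_negative_type.
- apply/seteqP; split=> [d [dm dneg]|d [dm [Q Ql dQ]]] /=.
    by split=> //; exact: strict_negative_type_Omega n0 dm.1 dneg.
  split=> //; rewrite -[d]dE dQ; exact: Omega_strict_negative_type.
- apply/seteqP; split=> [_ [d [dm dneg] <-]|_ [Q Ql <-]] /=.
    by have [Q Ql ->] := strict_negative_type_Omega _ n0 dm dneg; exists Q.
  exists (Omega Q); last exact: distance_matrix_fun.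
  by split; [exact: Omega_semimetric|exact: Omega_strict_negative_type].
Qed.
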